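(* Let $R$ be an associative ring with unit and let $(\mathcal A,\mathcal B)$ be a hereditary complete cotorsion pair in $\mathrm{Mod}\,R$. Assume that $\mathrm{pd}_{\mathcal A}(\mathcal A)<\infty$, and set $\alpha=\mathrm{resdim}_{\mathcal A}(\mathcal P)$ and $\beta=\mathrm{resdim}_{\mathcal A}(\mathcal P^{<\infty})$ (values in $\{0,1,2,\dots\}\cup\{\infty\}$). Then: (a) $\alpha\le \mathrm{Findim}(R_R)\le \mathrm{pd}_{\mathcal A}(\mathcal A)+\alpha$. (b) $\beta\le \mathrm{findim}(R_R)\le \mathrm{pd}_{\mathcal A}(\mathcal A)+\beta$.
   Context: $\mathrm{Mod}\,R$ is the category of all right $R$-modules; $\mathrm{mod}\,R$ is the full subcategory of modules possessing a projective resolution consisting of finitely generated projective modules. $\mathcal P$ is the class of all $M\in\mathrm{Mod}\,R$ with finite projective dimension, and $\mathcal P^{<\infty}=\mathcal P\cap\mathrm{mod}\,R$. $\mathrm{Findim}(R_R)=\sup\{\mathrm{pd}\,M: M\in\mathcal P\}$ and $\mathrm{findim}(R_R)=\sup\{\mathrm{pd}\,M: M\in\mathcal P^{<\infty}\}$. For a class $\mathcal X$ of modules and a module $M$, $\mathrm{pd}_{\mathcal X}(M)$ is the least $n\ge 0$ such that $\mathrm{Ext}^j_R(M,X)=0$ for all $X\in\mathcal X$ and all $j>n$ ($\infty$ if there is none); for a class $\mathcal Y$, $\mathrm{pd}_{\mathcal X}(\mathcal Y)=\sup\{\mathrm{pd}_{\mathcal X}(Y):Y\in\mathcal Y\}$.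 $\mathrm{resdim}_{\mathcal X}(M)$ is the least $n\ge 0$ such that there is an exact sequence $0\to X_n\to\cdots\to X_1\to X_0\to M\to 0$ with all $X_i\in\mathcal X$ ($\infty$ if there is none), and $\mathrm{resdim}_{\mathcal X}(\mathcal Y)=\sup\{\mathrm{resdim}_{\mathcal X}(Y):Y\in\mathcal Y\}$. A pair $(\mathcal A,\mathcal B)$ of classes of modules is a cotorsion pair if $\mathcal A=\{M:\mathrm{Ext}^1_R(M,B)=0\ \forall B\in\mathcal B\}$ and $\mathcal B=\{M:\mathrm{Ext}^1_R(A,M)=0\ \forall A\in\mathcal A\}$. It is complete if for every module $M$ there are short exact sequences $0\to B\to A\to M\to 0$ and $0\to M\to B'\to A'\to 0$ with $A,A'\in\mathcal A$, $B,B'\in\mathcal B$. It is hereditary if $\mathrm{Ext}^i_R(A,B)=0$ for all $i\ge 1$, $A\in\mathcal A$, $B\in\mathcal B$. *)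

(* Defs.v *)
From HB Require Import structures.
From mathcomp Require Import all_boot all_order all_algebra.
From mathcomp Require Import boolp functions.

Set Implicit Arguments.
Unset Strict Implicit.
Unset Printing Implicit Defensive.

Import GRing.Theory.

Local Open Scope ring_scope.

(* Extended natural numbers. *)

Inductive enat : Type := Fin of nat | Infty.

Definition enat_le (x y : enat) : Prop :=
  match x, y with
  | _, Infty => True
  | Infty, Fin _ => False
  | Fin m, Fin n => (m <= n)%N
  end.

Definition enat_add (x y : enat) : enat :=
  match x, y with
  | Fin m, Fin n => Fin (m + n)
  | _, _ => Infty
  end.

Declare Scope enat_scope.
Delimit Scope enat_scope with EN.
Bind Scope enat_scope with enat.
Notation "x <= y" := (enat_le x y) : enat_scope.
Notation "x + y" := (enat_add x y) : enat_scope.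

(* The least n such that P n, and Infty if there is none. *)
Definition enat_least (P : nat -> Prop) : enat :=
  match pselect (exists n, `[< P n >]) with
  | left exP => Fin (ex_minn exP)
  | right _ => Infty
  end.

(* The supremum of the f i with C i is the least finite upper bound, or Infty
   if there is none; in particular the empty supremum is 0. *)
Definition enat_sup (I : Type) (C : I -> Prop) (f : I -> enat) : enat :=
  enat_least (fun n => forall i, C i -> (f i <= Fin n)%EN).

(* Everything below is stated for left modules over S.  Right R-modules are
   obtained with S := R^c, the converse (opposite) ring of R. *)

Definition exact_at (S : pzRingType) (U V W : lmodType S)
    (f : {linear U -> V}) (g : {linear V -> W}) : Prop :=
  forall v, g v = 0 <-> exists u, f u = v.

Definition short_exact (S : pzRingType) (U V W : lmodType S)
    (f : {linear U -> V}) (g : {linear V -> W}) : Prop :=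
  [/\ injective f, exact_at f g & forall w, exists v, g v = w].

Definition projective (S : pzRingType) (P : lmodType S) : Prop :=
  forall (V W : lmodType S) (g : {linear V -> W}) (f : {linear P -> W}),
    (forall w, exists v, g v = w) ->
    exists h : {linear P -> V}, forall x, g (h x) = f x.

Definition finitely_generated (S : pzRingType) (P : lmodType S) : Prop :=
  exists (n : nat) (e : 'I_n -> P),
    forall x, exists c : 'I_n -> S, x = \sum_(i < n) c i *: e i.

Definition zero_module (S : pzRingType) (V : lmodType S) : Prop :=
  forall x : V, x = 0.

(* An exact sequence ... -> X_2 -> X_1 -> X_0 -> M -> 0, with no condition on
   the X_n. *)
Record resolution (S : pzRingType) (M : lmodType S) := Resolution {
  res_mod : nat -> lmodType S;
  res_diff : forall n, {linear res_mod n.+1 -> res_mod n};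
  res_aug : {linear res_mod 0 -> M};
  res_aug_surj : forall m, exists x, res_aug x = m;
  res_exact0 : exact_at (res_diff 0) res_aug;
  res_exactS : forall n, exact_at (res_diff n.+1) (res_diff n)
}.

Definition projective_resolution (S : pzRingType) (M : lmodType S)
    (Q : resolution M) : Prop :=
  forall n, projective (res_mod Q n).

(* The free module on a set T: finitely supported functions T -> S. *)

Section FreeModule.
Variables (S : pzRingType) (T : choiceType).

Definition finsupp : {pred (T -> S^o)} :=
  fun f => `[< exists s : seq T, forall t, f t != 0 -> t \in s >].

Lemma finsuppP (f : T -> S^o) :
  reflect (exists s : seq T, forall t, f t != 0 -> t \in s) (f \in finsupp).
Proof. exact: asboolP. Qed.

Fact finsupp_submod_closed : submod_closed finsupp.
Proof.
split; first by apply/finsuppP; exists [::] => t; rewrite eqxx.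
move=> a f g /finsuppP[s fs] /finsuppP[s' gs']; apply/finsuppP.
exists (s ++ s') => t; rewrite mem_cat; apply: contraNT.
rewrite negb_or => /andP[ts ts'].
have /eqP ft : f t == 0 by apply: contraNT ts => /fs.
have /eqP gt : g t == 0 by apply: contraNT ts' => /gs'.
by rewrite /GRing.add /= /GRing.scale /= ft gt scaler0 addr0.
Qed.

HB.instance Definition _ :=
  GRing.isSubmodClosed.Build S (T -> S^o) finsupp finsupp_submod_closed.

Record free_module := FreeModule {
  free_fun :> T -> S^o;
  free_funP : free_fun \in finsupp
}.

HB.instance Definition _ := [isSub for free_fun].
HB.instance Definition _ := [Choice of free_module by <:].
HB.instance Definition _ := [SubChoice_isSubLmodule of free_module by <:].

Definition free_supp (f : free_module) : seq T :=
  undup (projT1 (cid (elimT (finsuppP _) (free_funP f)))).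

Lemma free_suppP (f : free_module) t : f t != 0 -> t \in free_supp f.
Proof. by rewrite mem_undup; case: cid => s /= fs; apply: fs. Qed.

Variable V : lmodType S.

(* The linear extension of g : T -> V. *)
Definition free_lift (g : T -> V) (f : free_module) : V :=
  \sum_(t <- free_supp f) (f t : S) *: g t.

Lemma free_liftE g (f : free_module) (s : seq T) :
    uniq s -> (forall t, f t != 0 -> t \in s) ->
  free_lift g f = \sum_(t <- s) (f t : S) *: g t.
Proof.
move=> us fs; rewrite /free_lift.
have red (r : seq T) : \sum_(t <- r) (f t : S) *: g t
    = \sum_(t <- [seq t <- r | f t != 0]) (f t : S) *: g t.
  rewrite big_filter [RHS]big_mkcond /=; apply: eq_bigr => t _.
  by case: eqP => // ->; rewrite scale0r.
rewrite red [RHS]red; apply/perm_big/uniq_perm.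
- by rewrite filter_uniq ?undup_uniq.
- by rewrite filter_uniq.
move=> t; rewrite !mem_filter; have [//|ft /=] := eqVneq (f t) 0.
by rewrite (free_suppP ft) (fs _ ft).
Qed.

Lemma free_lift_is_linear g : linear (free_lift g).
Proof.
move=> a f h.
pose s := undup (free_supp f ++ free_supp h).
have fs t : f t != 0 -> t \in s.
  by move=> ft; rewrite mem_undup mem_cat free_suppP.
have hs t : h t != 0 -> t \in s.
  by move=> ht; rewrite mem_undup mem_cat (free_suppP ht) orbT.
have E t : (a *: f + h) t = a * f t + h t by [].
rewrite !(@free_liftE g _ s) ?undup_uniq //.
  rewrite scaler_sumr -big_split; apply: eq_bigr => t _.
  by rewrite scalerA /=; rewrite -scalerDl; congr (_ *: _); apply: E.
move=> t; apply: contraNT => ts; apply/eqP; rewrite [LHS]E.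
have /eqP -> : f t == 0 by apply: contraNT ts => /fs.
have /eqP -> : h t == 0 by apply: contraNT ts => /hs.
by rewrite mulr0 addr0.
Qed.

HB.instance Definition _ g :=
  GRing.isLinear.Build S free_module V *:%R (free_lift g)
    (free_lift_is_linear g).

Definition delta_fun (t u : T) : S^o := (t == u)%:R.

Fact delta_finsupp t : delta_fun t \in finsupp.
Proof.
apply/finsuppP; exists [:: t] => u; rewrite inE /delta_fun (eq_sym t).
by have [//|_] := boolP (u == t); rewrite eqxx.
Qed.

Definition free_basis t : free_module := FreeModule (delta_finsupp t).

Lemma free_lift_basis g t : free_lift g (free_basis t) = g t.
Proof.
rewrite (@free_liftE _ _ [:: t]) //.
  by rewrite big_seq1 /= /delta_fun eqxx scale1r.
move=> u; rewrite /= /delta_fun inE (eq_sym t).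
by have [//|_] := boolP (u == t); rewrite eqxx.
Qed.

End FreeModule.

Lemma free_expand (S : pzRingType) (T : choiceType) (f : free_module S T) :
  f = \sum_(t <- free_supp f) (f t : S) *: free_basis S t.
Proof.
apply/val_inj/funext => u /=.
have E (r : seq T) : free_fun (\sum_(t <- r) (f t : S) *: free_basis S t) u
    = \sum_(t <- r) f t * (t == u)%:R.
  by elim: r => [|t r IH]; rewrite ?big_nil // !big_cons -IH.
rewrite E.
have [fu|fu] := eqVneq (f u) 0.
  rewrite fu big1 // => t _; have [->|_] := eqVneq t u; last by rewrite mulr0.
  by rewrite fu mul0r.
rewrite (bigD1_seq u) ?undup_uniq ?free_suppP //= eqxx mulr1 big1 ?addr0 //.
by move=> t /negPf ->; rewrite mulr0.
Qed.

Lemma free_projective (S : pzRingType) (T : choiceType) :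
  projective (free_module S T).
Proof.
move=> V W g f gsurj.
pose k t := projT1 (cid (gsurj (f (free_basis S t)))).
have kE t : g (k t) = f (free_basis S t) by rewrite /k; case: cid.
exists (free_lift k) => x /=.
rewrite [in RHS](free_expand x) !raddf_sum; apply: eq_bigr => t _ /=.
by rewrite !linearZ /= kE.
Qed.

(* Kernels as modules. *)

Section Kernel.
Variables (S : pzRingType) (U V : lmodType S) (f : {linear U -> V}).

Definition ker_pred : {pred U} := fun x => f x == 0.

Fact ker_submod_closed : submod_closed ker_pred.
Proof.
split=> [|a x y]; rewrite !unfold_in ?linear0 // => /eqP fx /eqP fy.
by rewrite linearP fx fy scaler0 addr0.
Qed.

HB.instance Definition _ :=
  GRing.isSubmodClosed.Build S U ker_pred ker_submod_closed.

Record kernel := Kernel { ker_val :> U; ker_valP : ker_val \in ker_pred }.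

HB.instance Definition _ := [isSub for ker_val].
HB.instance Definition _ := [Choice of kernel by <:].
HB.instance Definition _ := [SubChoice_isSubLmodule of kernel by <:].

End Kernel.

(* The canonical free resolution of M: each step covers the previous kernel by
   the free module on its underlying set. *)

Section FreeResolution.
Variables (S : pzRingType) (M : lmodType S).

Definition free_cover (N : lmodType S) : {linear free_module S N -> N} :=
  free_lift (fun x : N => x).

Lemma free_cover_surj (N : lmodType S) (x : N) : exists f, free_cover N f = x.
Proof. by exists (free_basis S x); apply: free_lift_basis. Qed.

Fixpoint syzygy (n : nat) : lmodType S :=
  if n is n'.+1 then kernel (free_cover (syzygy n')) else M.

Definition free_res_diff n :
    {linear free_module S (syzygy n.+1) -> free_module S (syzygy n)} :=
  (val : kernel (free_cover (syzygy n)) -> _) \o free_cover (syzygy n.+1).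

Lemma free_res_exact n (N : lmodType S)
    (g : {linear free_module S (syzygy n) -> N}) :
  (forall x, g x = 0 <-> free_cover (syzygy n) x = 0) ->
  exact_at (free_res_diff n) g.
Proof.
move=> gE v; split=> [/gE vK|[u <-]].
  have /= vP : v \in ker_pred (free_cover (syzygy n)) by apply/eqP.
  have [u uE] := free_cover_surj (Kernel vP : syzygy n.+1).
  by exists u; rewrite /= [free_lift _ _]uE.
by apply/gE/eqP; apply: ker_valP.
Qed.

Lemma free_res_exactS n : exact_at (free_res_diff n.+1) (free_res_diff n).
Proof.
apply: free_res_exact => x; split=> [xE|xE]; last first.
  by rewrite /free_res_diff /= [free_lift _ _]xE.
by apply/val_inj.
Qed.

Definition free_resolution : resolution M :=
  @Resolution S M (fun n => free_module S (syzygy n)) free_res_diff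
    (free_cover M) (@free_cover_surj M)
    (@free_res_exact 0 M (free_cover M) (fun x => iff_refl _))
    free_res_exactS.

Lemma free_resolution_projective : projective_resolution free_resolution.
Proof. by move=> n; apply: free_projective. Qed.

End FreeResolution.

(* H^n (Hom_S (X_*, N)) = 0, i.e. every n-cocycle is an n-coboundary. *)
Definition Hom_acyclic (S : pzRingType) (M : lmodType S) (Q : resolution M)
    (N : lmodType S) (n : nat) : Prop :=
  forall f : {linear res_mod Q n -> N},
    (forall x, f (res_diff Q n x) = 0) ->
    match n return {linear res_mod Q n -> N} -> Prop with
    | 0 => fun f => forall x, f x = 0
    | m.+1 => fun f =>
        exists g : {linear res_mod Q m -> N}, forall x, f x = g (res_diff Q m x)
    end f.

(* Ext^n_S (M, N) = 0. *)
Definition Ext_zero (S : pzRingType) (n : nat) (M N : lmodType S) : Prop :=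
  Hom_acyclic (free_resolution M) N n.

Definition module_class (S : pzRingType) := lmodType S -> Prop.

(* An exact sequence 0 -> X_n -> ... -> X_0 -> M -> 0 is encoded as a resolution
   of M which is zero in degrees > n. *)
Definition resdim (S : pzRingType) (X : module_class S) (M : lmodType S) : enat :=
  enat_least (fun n => exists Q : resolution M,
    (forall i, (i <= n)%N -> X (res_mod Q i)) /\
    (forall i, (n < i)%N -> zero_module (res_mod Q i))).

Definition resdim_class (S : pzRingType) (X Y : module_class S) : enat :=
  enat_sup Y (resdim X).

Definition pd_rel (S : pzRingType) (X : module_class S) (M : lmodType S) : enat :=
  enat_least (fun n => forall N, X N -> forall j, (n < j)%N -> Ext_zero j M N).

Definition pd_rel_class (S : pzRingType) (X Y : module_class S) : enat :=
  enat_sup Y (pd_rel X).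

Definition pd (S : pzRingType) (M : lmodType S) : enat :=
  resdim (@projective S) M.

Definition finite_pd (S : pzRingType) : module_class S :=
  fun M => pd M <> Infty.

Definition fg_resolved (S : pzRingType) : module_class S :=
  fun M => exists Q : resolution M, projective_resolution Q /\
    forall n, finitely_generated (res_mod Q n).

Definition finite_pd_fg (S : pzRingType) : module_class S :=
  fun M => finite_pd M /\ fg_resolved M.

Definition Findim (S : pzRingType) : enat := enat_sup (@finite_pd S) (@pd S).

Definition findim (S : pzRingType) : enat := enat_sup (@finite_pd_fg S) (@pd S).

Definition cotorsion_pair (S : pzRingType) (A B : module_class S) : Prop :=
  (forall M, A M <-> forall N, B N -> Ext_zero 1 M N) /\
  (forall N, B N <-> forall M, A M -> Ext_zero 1 M N).

Definition complete_pair (S : pzRingType) (A B : module_class S) : Prop :=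
  forall M : lmodType S,
    (exists (V U : lmodType S) (f : {linear V -> U}) (g : {linear U -> M}),
       [/\ B V, A U & short_exact f g]) /\
    (exists (V U : lmodType S) (f : {linear M -> V}) (g : {linear V -> U}),
       [/\ B V, A U & short_exact f g]).

Definition hereditary_pair (S : pzRingType) (A B : module_class S) : Prop :=
  forall M N, A M -> B N -> forall i, (1 <= i)%N -> Ext_zero i M N.

(* Main.v *)
(* Projectives lie in A, so a projective resolution is an A-resolution; this
   gives the lower bounds.  For the upper bounds, let p = pd_A(A) and let M have
   an A-resolution of length n.  Dimension shifting gives Ext^j(M, X) = 0 for
   all X in A, in particular for all projective X, and all j > p + n.  If M also
   has some finite projective resolution, then its (p + n)-th syzygy K has a
   finite projective resolution and no Ext^j, j > 0, into projectives.  By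
   induction on the length, the kernel L of the cover P -> K is projective, so
   Ext^1(K, L) = 0 splits the cover and K is projective. *)

From HB Require Import structures.
Require Import Defs.
From mathcomp Require Import all_boot all_order all_algebra.
From mathcomp Require Import boolp.

Set Implicit Arguments.
Unset Strict Implicit.
Unset Printing Implicit Defensive.

Import GRing.Theory.

Local Open Scope ring_scope.

(** * Linear maps, short exact sequences and projective modules *)

Section LinearMaps.
Variable S : pzRingType.
Implicit Types U V W Y : lmodType S.

Lemma linear_bundle U V (h : U -> V) :
  linear h -> exists k : {linear U -> V}, forall x, k x = h x.
Proof.
move=> hL; pose m := GRing.isLinear.Build S U V *:%R h hL.
by exists (HB.pack_for {linear U -> V} h m).
Qed.

(** Exactness gives preimages under [f], and injectivity makes them unique, so the chosen preimages
    depend linearly on [y]. *)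
Lemma lift_mono U V W Y (f : {linear U -> V}) (g : {linear V -> W})
    (h : {linear Y -> V}) :
    injective f -> exact_at f g -> (forall y, g (h y) = 0) ->
  exists k : {linear Y -> U}, forall y, f (k y) = h y.
Proof.
move=> f_inj fg gh0.
have ex y : exists u, f u = h y by apply/fg.
pose k y := projT1 (cid (ex y)).
have kE y : f (k y) = h y by rewrite /k; case: cid.
have kL : linear k by move=> a x y; apply: f_inj; rewrite linearP !kE linearP.
by have [k' k'E] := linear_bundle kL; exists k' => y; rewrite k'E.
Qed.

(** [h] takes the same value at all preimages of a point under [g], so evaluating it at chosen
    preimages is linear. *)
Lemma factor_epi V W Y (g : {linear V -> W}) (h : {linear V -> Y}) :
    (forall w, exists v, g v = w) -> (forall v, g v = 0 -> h v = 0) ->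
  exists k : {linear W -> Y}, forall v, k (g v) = h v.
Proof.
move=> g_surj gh0.
pose s w := projT1 (cid (g_surj w)).
have sE w : g (s w) = w by rewrite /s; case: cid.
have hE u v : g u = g v -> h u = h v.
  by move=> guv; apply/subr0_eq; rewrite -linearB gh0 // linearB guv subrr.
have kL : linear (h \o s).
  by move=> a x y /=; rewrite -linearP; apply: hE; rewrite linearP !sE.
have [k kE] := linear_bundle kL.
by exists k => v; rewrite kE; apply: hE; rewrite sE.
Qed.

Lemma kernel_short_exact V W (g : {linear V -> W}) :
    (forall w, exists v, g v = w) ->
  short_exact (val : {linear kernel g -> V}) g.
Proof.
move=> g_surj; split=> [|v|//]; first exact: val_inj.
split=> [gv|[u <-]]; last by apply/eqP; apply: (ker_valP u).
have vK : v \in ker_pred g by apply/eqP.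
by exists (Kernel vK).
Qed.

Lemma syzygy_short_exact (M : lmodType S) n :
  short_exact (val : {linear syzygy M n.+1 -> free_module S (syzygy M n)})
    (free_cover (syzygy M n)).
Proof. exact/kernel_short_exact/free_cover_surj. Qed.

Lemma short_exact0 U V W (f : {linear U -> V}) (g : {linear V -> W}) u :
  short_exact f g -> g (f u) = 0.
Proof. by case=> _ fg _; apply/fg; exists u. Qed.

Lemma zero_module_projective U : zero_module U -> projective U.
Proof.
move=> U0 V W g f g_surj; exists (\0 : {linear U -> V}) => x.
by rewrite (U0 x) !linear0.
Qed.

Lemma retract_projective U V (f : {linear U -> V}) (g : {linear V -> U}) :
  cancel f g -> projective V -> projective U.
Proof.
move=> fK Vp X Y e h e_surj.
have [k kE] := Vp X Y e (h \o g) e_surj.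
by exists (k \o f) => x /=; rewrite kE /= fK.
Qed.

Lemma pair_inl_linear U V :
  exists h : {linear U -> (U * V)%type}, forall u, h u = (u, 0).
Proof.
apply: linear_bundle => a x y; apply: injective_projections => //=.
by rewrite scaler0 addr0.
Qed.

Lemma pair_inr_linear U V :
  exists h : {linear V -> (U * V)%type}, forall v, h v = (0, v).
Proof.
apply: linear_bundle => a x y; apply: injective_projections => //=.
by rewrite scaler0 addr0.
Qed.

Lemma prod_projective U V :
  projective U -> projective V -> projective (U * V)%type.
Proof.
move=> Up Vp X Y g f g_surj.
have [inl inlE] := pair_inl_linear U V.
have [inr inrE] := pair_inr_linear U V.
have [hl hlE] := Up X Y g (f \o inl) g_surj.
have [hr hrE] := Vp X Y g (f \o inr) g_surj.
have hL : linear (fun w : U * V => hl w.1 + hr w.2).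
  by move=> a x y /=; rewrite !linearP scalerDr addrACA.
have [h hE] := linear_bundle hL.
exists h => -[u v]; rewrite hE /= linearD hlE hrE /= inlE inrE -linearD.
by congr (f _); apply: injective_projections; rewrite /= ?addr0 ?add0r.
Qed.

End LinearMaps.

(** * Comparison of projective presentations, and vanishing of Ext *)

Section StableRetracts.
Variable S : pzRingType.
Implicit Types L M N P X : lmodType S.

(* M' is a direct summand of M up to projectives.  Syzygies preserve this
   relation, and Ext^n( - , N) = 0 passes from M to M' for n > 0; comparing two
   covers of the same module this way replaces chain homotopies. *)
Definition stable_retract M' M : Prop :=
  exists P, projective P /\
  exists (a : {linear M' -> M}) (b : {linear M -> M'})
    (c : {linear M' -> P}) (d : {linear P -> M'}),
    forall x, b (a x) + d (c x) = x.

Lemma retract_stable_retract M' M (a : {linear M' -> M}) (b : {linear M -> M'}) :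
  cancel a b -> stable_retract M' M.
Proof.
move=> aK; exists (free_module S M); split; first exact: free_projective.
by exists a, b, \0, \0 => x /=; rewrite addr0.
Qed.

Lemma stable_retract_refl M : stable_retract M M.
Proof. exact: (@retract_stable_retract M M idfun idfun). Qed.

(** Surjectivity of restriction from Hom(P, N) to Hom(L, N). For 0 -> L -> P -> M -> 0 with [P]
    projective it says that Ext^1(M, N) = 0. *)
Definition extends L P (i : {linear L -> P}) N : Prop :=
  forall f : {linear L -> N}, exists h : {linear P -> N}, forall x, h (i x) = f x.

Section Comparison.
Variables (L' P' M' L P M : lmodType S).
Variables (i' : {linear L' -> P'}) (p' : {linear P' -> M'}).
Variables (i : {linear L -> P}) (p : {linear P -> M}).
Hypotheses (ip' : short_exact i' p') (P'proj : projective P').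
Hypotheses (ip : short_exact i p) (Pproj : projective P).
Hypothesis MM : stable_retract M' M.

(** A relative form of Schanuel's lemma: the maps witnessing [MM] lift to the covers, and the lifts
    restrict to the kernels. The last identity makes [L'] a retract of [L] up to maps through
    [P']. *)
Lemma stable_retract_comparison :
  exists (a : {linear P' -> P}) (al : {linear L' -> L}) (be : {linear L -> L'})
    (s : {linear P' -> L'}),
    (forall x, i (al x) = a (i' x)) /\ forall x, be (al x) + s (i' x) = x.
Proof.
have [Q [Qproj [a0 [b0 [c [d abcd]]]]]] := MM.
have [i'_inj ex' p'_surj] := ip'; have [i_inj ex p_surj] := ip.
have [a aE] := P'proj (a0 \o p') p_surj.
have [b bE] := Pproj (b0 \o p) p'_surj.
have [e eE] := Qproj _ _ p' d p'_surj.
have [al alE] : exists al : {linear L' -> L}, forall y, i (al y) = (a \o i') y.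
  by apply: lift_mono => // y /=; rewrite aE /= (short_exact0 _ ip') linear0.
have [be beE] : exists be : {linear L -> L'}, forall y, i' (be y) = (b \o i) y.
  by apply: lift_mono => // y /=; rewrite bE /= (short_exact0 _ ip) linear0.
(* Applying [p'] to 1 - b a - e c p' gives (1 - b0 a0 - d c) p' = 0, so this map lands in [L']. On
   [L'] its last term vanishes because p' i' = 0. *)
have [s sE] : exists s : {linear P' -> L'},
    forall y, i' (s y) = (idfun \- (b \o a) \- (e \o c \o p')) y.
  apply: lift_mono => // y /=.
  rewrite !linearB bE /= aE /= eE -[X in X - _ - _]abcd.
  by rewrite addrAC addrK subrr.
exists a, al, be, s; split=> [//|x]; apply: i'_inj.
rewrite linearD beE sE /= alE /= (short_exact0 _ ip') !linear0 addr0.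
by rewrite addrC subrK.
Qed.

Lemma stable_retract_kernel : stable_retract L' L.
Proof.
have [a [al [be [s [_ E]]]]] := stable_retract_comparison.
by exists P'; split=> //; exists al, be, i', s.
Qed.

Lemma extends_stable_retract N : extends i N -> extends i' N.
Proof.
have [a [al [be [s [alE E]]]]] := stable_retract_comparison.
(* If [h] extends f be, then h a + f s restricts along [i'] to f (be al + s i') = f. *)
move=> iN f; have [h hE] := iN (f \o be).
exists ((h \o a) \+ (f \o s)) => x /=.
by rewrite -alE hE /= -linearD E.
Qed.

End Comparison.

(** A cocycle in degree n+1 kills the image of the next differential, so it factors through the
    cover of the (n+1)-st syzygy. It is a coboundary exactly when the induced map extends to the
    free module in degree n. *)
Lemma Ext_zeroP M N n :
  Ext_zero n.+1 M N <->
  extends (val : {linear syzygy M n.+1 -> free_module S (syzygy M n)}) N.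
Proof.
have [v_inj vex c_surj] := syzygy_short_exact M n.+1.
split=> [MN f|MN f f0].
  have [|g gE] := MN (f \o free_cover (syzygy M n.+1)).
    move=> x; rewrite /= -[RHS](linear0 f); congr (f _).
    exact: (short_exact0 _ (syzygy_short_exact M n.+1)).
  exists g => x; have [y <-] := free_cover_surj x.
  by have /= := gE y; rewrite /free_res_diff /= => ->.
  have [|k kE] := factor_epi (g := free_cover (syzygy M n.+1)) (h := f) c_surj.
    move=> v cv.
    have /free_res_exactS[u <-] : free_res_diff M n v = 0.
      by rewrite /free_res_diff /= [free_lift _ _]cv.
    exact: f0.
  have [g gE] := MN k.
  by exists g => x; rewrite /= /free_res_diff /= gE kE.
Qed.

Lemma stable_retract_syzygy M' M n :
  stable_retract M' M -> stable_retract (syzygy M' n) (syzygy M n).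
Proof.
move=> MM; elim: n => [//|n IHn].
apply: (stable_retract_kernel (syzygy_short_exact M' n) _
  (syzygy_short_exact M n) _ IHn); exact: free_projective.
Qed.

Lemma Ext_zero_stable_retract M' M N n :
  stable_retract M' M -> Ext_zero n.+1 M N -> Ext_zero n.+1 M' N.
Proof.
move=> /(stable_retract_syzygy n) MM /Ext_zeroP MN; apply/Ext_zeroP.
apply: (extends_stable_retract (syzygy_short_exact M' n) _
  (syzygy_short_exact M n) _ MM MN); exact: free_projective.
Qed.

(** Ext^1 may be computed from any projective presentation: compare it with the free cover in both
    directions, [M] being a stable retract of itself. *)
Lemma Ext_zero1P L P M N (i : {linear L -> P}) (p : {linear P -> M}) :
  short_exact i p -> projective P -> Ext_zero 1 M N <-> extends i N.
Proof.
move=> ip Pproj.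
have FM := syzygy_short_exact M 0.
have Fproj : projective (free_module S (syzygy M 0)) by apply: free_projective.
split=> [/Ext_zeroP|iN].
  exact: (extends_stable_retract ip Pproj FM Fproj (stable_retract_refl M)).
apply/Ext_zeroP.
exact: (extends_stable_retract FM Fproj ip Pproj (stable_retract_refl M)).
Qed.

Lemma syzygySr M n : syzygy M n.+1 = syzygy (syzygy M 1) n.
Proof. by elim: n => [//|n IHn]; rewrite [RHS]/= -IHn. Qed.

(** Both sides express the vanishing of Ext^1 on the same module, the (n+1)-st syzygy of [M]. *)
Lemma Ext_zero_syzygy M N n : Ext_zero n.+2 M N <-> Ext_zero n.+1 (syzygy M 1) N.
Proof.
have E K j : Ext_zero j.+1 K N <-> Ext_zero 1 (syzygy K j) N.
  by split=> /Ext_zeroP KN; apply/Ext_zeroP.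
by split=> [/(E _ _).1|/(E _ _).1 KN]; last apply/(E _ _).2;
  rewrite (syzygySr M n) // => /(E _ _).2.
Qed.

(** Dimension shifting along an arbitrary projective cover: [L] and the first free syzygy of [M] are
    stable retracts of each other. *)
Lemma Ext_zero_shift L P M N (i : {linear L -> P}) (p : {linear P -> M}) n :
    short_exact i p -> projective P ->
  Ext_zero n.+2 M N <-> Ext_zero n.+1 L N.
Proof.
move=> ip Pproj.
have FM := syzygy_short_exact M 0.
have Fproj : projective (free_module S (syzygy M 0)) by apply: free_projective.
have MM := stable_retract_refl M.
split=> [/Ext_zero_syzygy|LN]; last apply/Ext_zero_syzygy; last move: LN.
  exact/Ext_zero_stable_retract/(stable_retract_kernel ip Pproj FM Fproj MM).
exact/Ext_zero_stable_retract/(stable_retract_kernel FM Fproj ip Pproj MM).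
Qed.

Lemma projective_retraction L P M (i : {linear L -> P}) (p : {linear P -> M}) :
    short_exact i p -> projective M ->
  exists r : {linear P -> L}, forall x, r (i x) = x.
Proof.
move=> ip Mproj; have [i_inj ex p_surj] := ip.
have [s sE] := Mproj _ _ p idfun p_surj.
have [r rE] : exists r : {linear P -> L}, forall x, i (r x) = (idfun \- (s \o p)) x.
  by apply: lift_mono => // y; rewrite linearB /= sE subrr.
exists r => x; apply: i_inj.
by rewrite rE /= (short_exact0 _ ip) linear0 subr0.
Qed.

Lemma projective_syzygy P n : projective P -> projective (syzygy P n).
Proof.
move=> Pproj; elim: n => [//|n IHn].
(* The free cover of a projective module splits, so its kernel is a retract of a free module. *)
have [r rE] := projective_retraction (syzygy_short_exact P n) IHn.
exact: (retract_projective rE (@free_projective _ _)).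
Qed.

Lemma projective_Ext_zero P N n : projective P -> Ext_zero n.+1 P N.
Proof.
move=> /(@projective_syzygy P n) Pproj; apply/Ext_zeroP => f.
have [r rE] := projective_retraction (syzygy_short_exact P n) Pproj.
by exists (f \o r) => x; rewrite /= rE.
Qed.

(** * Pieces of the long exact sequence of Ext in the first variable *)

Section Horseshoe.
Variables (L X M : lmodType S) (i : {linear L -> X}) (p : {linear X -> M}).
Variables (KL PL : lmodType S) (iL : {linear KL -> PL}) (pL : {linear PL -> L}).
Variables (KM PM : lmodType S) (iM : {linear KM -> PM}) (pM : {linear PM -> M}).
Hypotheses (ip : short_exact i p) (ipL : short_exact iL pL).
Hypotheses (ipM : short_exact iM pM) (PMproj : projective PM).

(** Lift [pM] through [p] to [q]; then i pL + q maps the product onto [X], and its kernel is an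
    extension of [KM] by [KL]. The two equations relate this extension to the inclusions of the
    kernels, as needed to extend maps by hand. *)
Lemma horseshoe :
  exists (K : lmodType S) (j : {linear K -> (PL * PM)%type})
    (pi : {linear (PL * PM)%type -> X}) (phi : {linear KL -> K})
    (psi : {linear K -> KM}),
    [/\ short_exact j pi, short_exact phi psi,
        forall x, j (phi x) = (iL x, 0) & forall k, iM (psi k) = (j k).2].
Proof.
have [i_inj ex p_surj] := ip; have [iL_inj exL pL_surj] := ipL.
have [iM_inj exM pM_surj] := ipM.
have [q qE] := PMproj pM p_surj.
have piL : linear (fun w : PL * PM => i (pL w.1) + q w.2).
  by move=> a x y /=; rewrite !linearP scalerDr addrACA.
have [pi piE] := linear_bundle piL.
have pi_surj x : exists w, pi w = x.
  have [v vE] := pM_surj (p x).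
  have /ex[l lE] : p (x - q v) = 0 by rewrite linearB qE vE subrr.
  have [u uE] := pL_surj l.
  by exists (u, v); rewrite piE /= uE lE subrK.
pose j : {linear kernel pi -> (PL * PM)%type} := val.
have jpi : short_exact j pi by apply: kernel_short_exact.
have [j_inj exj _] := jpi.
have [inl inlE] := pair_inl_linear PL PM.
have [phi phiE] : exists phi : {linear KL -> kernel pi}, forall x, j (phi x) = (inl \o iL) x.
  apply: lift_mono => // x.
  by rewrite /= inlE piE /= (short_exact0 _ ipL) !linear0 addr0.
have sndL : linear (fun k : kernel pi => (j k).2).
  by move=> a x y; rewrite linearP.
have [snd2 sndE] := linear_bundle sndL.
have [psi psiE] : exists psi : {linear kernel pi -> KM},
    forall k, iM (psi k) = snd2 k.
  apply: lift_mono => // k; rewrite sndE -qE.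
  have : pi (j k) = 0 by apply: (short_exact0 _ jpi).
  rewrite piE => /(congr1 p).
  by rewrite linearD linear0 (short_exact0 _ ip) add0r.
exists (kernel pi), j, pi, phi, psi; split=> // [|x|k]; last 2 first.
- by rewrite phiE /= inlE.
- by rewrite psiE sndE.
split=> [x y /(congr1 j)|k|v].
- by rewrite !phiE /= !inlE => -[/iL_inj].
- split=> [psi0|[x <-]].
    have k2 : (j k).2 = 0 by rewrite -sndE -psiE psi0 linear0.
    have := short_exact0 k jpi; rewrite piE k2 linear0 addr0 -(linear0 i).
    move=> /i_inj /exL[x xE]; exists x; apply: j_inj.
    by rewrite phiE /= inlE xE -k2 -surjective_pairing.
  by apply: iM_inj; rewrite psiE sndE phiE /= inlE linear0.
(* To hit [v], the value of [q] at [iM v] comes from some [l] in [L]; a preimage of [- l] in [PL] as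
   first component cancels it. *)
have /ex[l lE] : p (q (iM v)) = 0 by rewrite qE (short_exact0 _ ipM).
have [u uE] := pL_surj (- l).
have /exj[k kE] : pi (u, iM v) = 0.
  by rewrite piE /= uE linearN lE addNr.
by exists k; apply: iM_inj; rewrite psiE sndE kE.
Qed.

End Horseshoe.

(** Exactness of Ext(M, N) -> Ext(X, N) -> Ext(L, N) at the middle term. Shifting to the kernels of
    the horseshoe reduces to degree 1. *)
Lemma Ext_zero_middle L X M N (i : {linear L -> X}) (p : {linear X -> M}) n :
    short_exact i p -> Ext_zero n.+1 L N -> Ext_zero n.+1 M N ->
  Ext_zero n.+1 X N.
Proof.
elim: n L X M i p => [|n IHn] L X M i p ip LN MN.
all: have FL := syzygy_short_exact L 0; have FM := syzygy_short_exact M 0.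
all: have FLproj : projective (free_module S (syzygy L 0)) by apply: free_projective.
all: have FMproj : projective (free_module S (syzygy M 0)) by apply: free_projective.
all: have [K [j [pi [phi [psi [jpi phipsi jphi ipsi]]]]]] := horseshoe ip FL FM FMproj.
all: have Pproj := prod_projective FLproj FMproj.
  apply/(Ext_zero1P _ jpi Pproj) => f.
  have [g gE] := (Ext_zero1P N FL FLproj).1 LN (f \o phi).
  have fstL : linear (fun w : free_module S L * free_module S M => g w.1).
    by move=> a x y; rewrite -linearP.
  have [g1 g1E] := linear_bundle fstL.
  (* First extend [f] on the kernel over [L], giving [g1]. The rest f - g1 j vanishes there, hence
     descends to the kernel over [M], where it extends as well. *)
  have [k kE] : exists k : {linear kernel (free_cover M) -> N},
      forall x, k (psi x) = (f \- (g1 \o j)) x.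
    have [_ exK psi_surj] := phipsi; apply: factor_epi => // x /exK[y <-] /=.
    by rewrite g1E jphi /= gE /= subrr.
  have [h hE] := (Ext_zero1P N FM FMproj).1 MN k.
  have sndL : linear (fun w : free_module S L * free_module S M => h w.2).
    by move=> a x y; rewrite -linearP.
  have [h2 h2E] := linear_bundle sndL.
  exists (g1 \+ h2) => x /=.
  by rewrite h2E -ipsi hE kE /= addrC subrK.
apply/(Ext_zero_shift _ n jpi Pproj)/(IHn _ _ _ _ _ phipsi).
  exact/(Ext_zero_shift _ n FL FLproj).
exact/(Ext_zero_shift _ n FM FMproj).
Qed.

(* With a free cover c : F -> X, the composite F -> M has kernel K = c^-1(L),
   which is an extension of L by the syzygy of X. *)
Lemma Ext_zero_right L X M N (i : {linear L -> X}) (p : {linear X -> M}) n :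
    short_exact i p -> Ext_zero n.+1 L N -> Ext_zero n.+2 X N ->
  Ext_zero n.+2 M N.
Proof.
move=> ip LN XN; have [i_inj ex p_surj] := ip.
have FX := syzygy_short_exact X 0; have [v_inj vex c_surj] := FX.
have Fproj : projective (free_module S (syzygy X 0)) by apply: free_projective.
pose c := free_cover X; pose g := p \o c.
have g_surj m : exists x, g x = m.
  by have [x <-] := p_surj m; have [y <-] := c_surj x; exists y.
have Kg := kernel_short_exact g_surj.
pose j : {linear kernel g -> free_module S X} := val.
have [j_inj exj _] : short_exact j g := Kg.
apply/(Ext_zero_shift _ n Kg Fproj).
have [phi phiE] : exists phi : {linear kernel c -> kernel g},
    forall x, j (phi x) = val x.
  apply: (lift_mono (h := val)) => // x.
  by rewrite /g /= [free_lift _ _](short_exact0 _ FX) linear0.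
have [psi psiE] : exists psi : {linear kernel g -> L},
    forall x, i (psi x) = (c \o j) x.
  by apply: lift_mono => // x; apply: (short_exact0 _ Kg).
apply: (@Ext_zero_middle (kernel c) _ L _ phi psi) => //; last first.
  exact/(Ext_zero_shift _ n FX Fproj).
split=> [x y /(congr1 j)|k|l].
- by rewrite !phiE => /val_inj.
- split=> [psi0|[x <-]].
    have /vex[x xE] : c (j k) = 0 by have := psiE k; rewrite psi0 linear0.
    by exists x; apply: j_inj; rewrite phiE.
  apply: i_inj; rewrite psiE linear0.
  exact: etrans (congr1 c (phiE x)) (short_exact0 x FX).
have [y yE] := c_surj (i l).
have /exj[k kE] : g y = 0 by rewrite /g /= [free_lift _ _]yE (short_exact0 _ ip).
by exists k; apply: i_inj; rewrite psiE -yE -kE.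
Qed.

End StableRetracts.

(** * Finite resolutions by a class of modules *)

Section Resolutions.
Variable S : pzRingType.
Implicit Types (L M N P : lmodType S) (X : module_class S).

(** The predicate minimised in [resdim], named for use in inductions on the length. *)
Definition resolved_by X n M : Prop :=
  exists Q : resolution M,
    (forall i, (i <= n)%N -> X (res_mod Q i)) /\
    (forall i, (n < i)%N -> zero_module (res_mod Q i)).

Lemma resolution_tail M (Q : resolution M) :
  exists Q' : resolution (kernel (res_aug Q)),
    forall i, res_mod Q' i = res_mod Q i.+1.
Proof.
have [v_inj vex _] := kernel_short_exact (@res_aug_surj _ _ Q).
have [c cE] := lift_mono (h := res_diff Q 0) v_inj vex
  (fun y => (res_exact0 _).2 (ex_intro _ y erefl)).
have c_surj x : exists y, c y = x.
  have /res_exact0[y yE] : res_aug Q (val x) = 0 by apply/vex; exists x.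
  by exists y; apply: v_inj; rewrite cE.
have c_exact : exact_at (res_diff Q 1) c.
  move=> y; rewrite -(res_exactS (r := Q) (n := 0) y) -cE.
  by split=> [->|cy0]; [rewrite linear0 | apply: v_inj].
by exists (@Resolution S _ (fun i => res_mod Q i.+1) (fun i => res_diff Q i.+1)
  c c_surj c_exact (fun i => @res_exactS _ _ Q i.+1)).
Qed.

(** The terms of the spliced resolution are equal to the given modules, not just isomorphic, because
    a [module_class] need not be closed under isomorphism. *)
Lemma resolution_splice L P M (i : {linear L -> P}) (p : {linear P -> M})
    (Q : resolution L) :
    short_exact i p ->
  exists Q' : resolution M, res_mod Q' 0 = P /\
    forall n, res_mod Q' n.+1 = res_mod Q n.
Proof.
move=> ip; have [i_inj ex p_surj] := ip.
pose md n := if n is n'.+1 then res_mod Q n' else P.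
pose df n : {linear md n.+1 -> md n} :=
  match n with 0 => i \o res_aug Q | n'.+1 => res_diff Q n' end.
have ex0 : exact_at (df 0) p.
  move=> x; split=> [/ex[y <-]|[y <-]]; last exact: (short_exact0 _ ip).
  by have [z <-] := res_aug_surj Q y; exists z.
have exS n : exact_at (df n.+1) (df n).
  case: n => [x|n]; last exact: res_exactS.
  rewrite -(res_exact0 (r := Q) x) /=.
  by split=> [|->]; rewrite ?linear0 // -(linear0 i) => /i_inj.
by exists (@Resolution S M md df p p_surj ex0 exS).
Qed.

Lemma resolved_by_zero M : zero_module M ->
  exists Q : resolution M, forall i, zero_module (res_mod Q i).
Proof.
move=> M0.
have M_exact : exact_at (\0 : {linear M -> M}) (\0 : {linear M -> M}).
  by move=> x; split=> // _; exists 0; rewrite linear0 (M0 x).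
have M_surj x : exists y, (\0 : {linear M -> M}) y = x.
  by exists 0; rewrite linear0 (M0 x).
by exists (@Resolution S M (fun=> M) (fun=> \0) \0 M_surj M_exact (fun=> M_exact)).
Qed.

(** The inductive step on lengths: the kernel of the augmentation is resolved by the tail. In length
    0 the augmentation is injective, so the kernel is zero. *)
Lemma resolved_by_short_exact X n M : resolved_by X n M ->
  exists L P (i : {linear L -> P}) (p : {linear P -> M}),
    [/\ short_exact i p, X P &
        if n is n'.+1 then resolved_by X n' L else zero_module L].
Proof.
case=> Q [QX Q0]; have ip := kernel_short_exact (@res_aug_surj _ _ Q).
exists (kernel (res_aug Q)), (res_mod Q 0), val, (res_aug Q).
split=> //; first exact: QX.
case: n QX Q0 => [|n] QX Q0.
  move=> x; have [v_inj vex _] := ip; apply: v_inj.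
  have /res_exact0[y yE] : res_aug Q (val x) = 0 by apply/vex; exists x.
  by rewrite -[LHS]yE (Q0 1 isT y) linear0.
have [Q' Q'E] := resolution_tail Q.
by exists Q'; split=> j jn; rewrite Q'E; [apply: QX | apply: Q0].
Qed.

Lemma resolved_byS X n L P M (i : {linear L -> P}) (p : {linear P -> M}) :
  short_exact i p -> X P -> resolved_by X n L -> resolved_by X n.+1 M.
Proof.
move=> ip XP [Q [QX Q0]]; have [Q' [Q'P Q'E]] := resolution_splice Q ip.
exists Q'; split=> -[|j] jn //; rewrite ?Q'P ?Q'E //; [exact: QX|exact: Q0].
Qed.

Lemma resolved_by0 X M : X M -> resolved_by X 0 M.
Proof.
move=> XM.
have id_surj (x : M) : exists y, (idfun : {linear M -> M}) y = x by exists x.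
have ip := kernel_short_exact id_surj.
have [|Q Q0] := @resolved_by_zero (kernel (idfun : {linear M -> M})).
  by move=> x; apply: val_inj; apply: (short_exact0 x ip).
have [Q' [Q'M Q'E]] := resolution_splice Q ip.
by exists Q'; split=> -[|j] jn //; rewrite ?Q'M ?Q'E.
Qed.

Lemma resolved_by_sub X Y n M :
  (forall N, X N -> Y N) -> resolved_by X n M -> resolved_by Y n M.
Proof. by move=> XY [Q [QX Q0]]; exists Q; split=> // i /QX /XY. Qed.

(** Each step of the resolution raises the bound by one, by exactness of Ext^j(L, N) -> Ext^(j+1)(M,
    N) -> Ext^(j+1)(P, N). *)
Lemma resolved_by_Ext_zero X M N p n :
    (forall L, X L -> forall j, (p < j)%N -> Ext_zero j L N) ->
    resolved_by X n M ->
  forall j, (p + n < j)%N -> Ext_zero j M N.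
Proof.
move=> XN; elim: n M => [|n IHn] M /resolved_by_short_exact.
  move=> [L [P [i [g [ig XP L0]]]]] [//|j]; rewrite addn0 => pj.
  have [_ ex g_surj] := ig.
  (* Here [g] is an isomorphism; its inverse [k] exhibits [M] as a retract of [P], so vanishing
     passes from [P] to [M]. *)
  have [|k kE] := factor_epi (h := idfun) g_surj.
    by move=> x /ex[y <-]; rewrite (L0 y) linear0.
  apply: (Ext_zero_stable_retract (M := P)); last exact: XN pj.
  apply: (retract_stable_retract (a := k) (b := g)) => x.
  by have [y <-] := g_surj x; rewrite kE.
move=> [L [P [i [g [ig XP Ln]]]]] j.
(* The strict bound p + n + 1 < j rules out degrees 0 and 1. *)
rewrite addnS; case: j => [|[|j]] // pj.
apply: (Ext_zero_right ig); first by apply: (IHn L Ln).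
by apply: (XN P XP); rewrite ltnS (leq_trans (leq_addr n p)) // ltnW.
Qed.

(** The identity of [L] extends to a retraction [r] of [i]; then 1 - i r kills the image of [i] and
    descends to a section of [p]. *)
Lemma projective_of_Ext_zero L P M (i : {linear L -> P}) (p : {linear P -> M}) :
  short_exact i p -> projective P -> Ext_zero 1 M L -> projective M.
Proof.
move=> ip Pproj /(Ext_zero1P L ip Pproj)/(_ idfun)[r rE].
have [i_inj ex p_surj] := ip.
have [|s sE] := factor_epi (h := idfun \- (i \o r)) p_surj.
  by move=> x /ex[y <-] /=; rewrite rE subrr.
apply: (retract_projective (f := s) (g := p)) Pproj => x.
have [y <-] := p_surj x.
by rewrite sE linearB /= (short_exact0 _ ip) subr0.
Qed.

(** The predecessor absorbs length 0, where the zero kernel is projective and so again has a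
    resolution of length 0. *)
Lemma finite_resolution_short_exact n M : resolved_by (@projective S) n M ->
  exists L P (i : {linear L -> P}) (p : {linear P -> M}),
    [/\ short_exact i p, projective P & resolved_by (@projective S) n.-1 L].
Proof.
move=> /resolved_by_short_exact[L [P [i [p [ip Pproj Ln]]]]].
exists L, P, i, p; split=> //; case: n Ln => //= L0.
exact/resolved_by0/zero_module_projective.
Qed.

Lemma resolved_by_projective0 n M :
    resolved_by (@projective S) n M ->
    (forall P, projective P -> forall j, (0 < j)%N -> Ext_zero j M P) ->
  projective M.
Proof.
elim: n M => [|n IHn] M /resolved_by_short_exact[L [P [i [p [ip Pproj Ln]]]]] MX.
(* Once [L] is known to be projective, it is itself an admissible coefficient module in [MX]. *)
all: apply: (projective_of_Ext_zero ip Pproj); apply: (MX) => //.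
  exact: zero_module_projective.
apply: (IHn L Ln) => X Xproj [//|j] _.
by apply/(Ext_zero_shift _ _ ip Pproj); apply: MX.
Qed.

(** Induction on the target bound [k], not on [n]: each cover removed lowers the Ext bound by one,
    until the kernel has no positive Ext into projectives and is projective. *)
Lemma resolved_by_projective_Ext_zero k n M :
    resolved_by (@projective S) n M ->
    (forall P, projective P -> forall j, (k < j)%N -> Ext_zero j M P) ->
  resolved_by (@projective S) k M.
Proof.
elim: k n M => [|k IHk] n M Mn MX.
  exact: resolved_by0 (resolved_by_projective0 Mn MX).
have [L [P [i [p [ip Pproj Ln]]]]] := finite_resolution_short_exact Mn.
apply: (resolved_byS ip Pproj); apply: (IHk _ _ Ln) => X Xproj [//|j] kj.
by apply/(Ext_zero_shift _ _ ip Pproj); apply: MX.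
Qed.

End Resolutions.

(** * Extended natural numbers and the two dimension bounds *)

Lemma enat_leastP (P : nat -> Prop) k :
  (enat_least P <= Fin k)%EN <-> exists2 n, (n <= k)%N & P n.
Proof.
rewrite /enat_least; case: pselect => [exP|nP] /=.
  case: ex_minnP => m /asboolP Pm mP; split=> [mk|[n nk Pn]]; first by exists m.
  exact: leq_trans (mP n (asboolT Pn)) nk.
by split=> // -[n nk Pn]; case: nP; exists n; apply/asboolP.
Qed.

Lemma enat_supP (I : Type) (C : I -> Prop) (f : I -> enat) k :
  (enat_sup C f <= Fin k)%EN <-> forall i, C i -> (f i <= Fin k)%EN.
Proof.
split=> [/enat_leastP[n nk fn] i Ci|fk]; last by apply/enat_leastP; exists k.
by case: (f i) (fn i Ci) => [m mn|//]; apply: leq_trans nk.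
Qed.

(** A projective resolution is also an [X]-resolution of the same length. Leaving [C] arbitrary
    covers the big and the little finitistic dimension at once. *)
Lemma resdim_le_Findim (S : pzRingType) (X C : module_class S) :
    (forall P, projective P -> X P) ->
  (resdim_class X C <= enat_sup C (@pd S))%EN.
Proof.
move=> projX; case E: (enat_sup C _) => [k|]; last by case: (resdim_class _ _).
have /enat_supP pdk : (enat_sup C (@pd S) <= Fin k)%EN by rewrite E /=.
apply/enat_supP => M /pdk /enat_leastP[n nk Mn].
by apply/enat_leastP; exists n => //; apply: resolved_by_sub Mn.
Qed.

Lemma finite_pd_resolved (S : pzRingType) (M : lmodType S) :
  finite_pd M -> exists n, resolved_by (@projective S) n M.
Proof.
rewrite /finite_pd; case pdm: (pd M) => [m|//] _.
have /enat_leastP[n _ Mn] : (pd M <= Fin m)%EN by rewrite pdm /=.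
by exists n.
Qed.

Lemma Findim_le_pd_rel_add_resdim (S : pzRingType) (X C : module_class S) :
    (forall P, projective P -> X P) -> (forall M, C M -> finite_pd M) ->
  (enat_sup C (@pd S) <= pd_rel_class X X + resdim_class X C)%EN.
Proof.
move=> projX C_pd.
case Ep: (pd_rel_class X X) => [p|]; last by case: (enat_sup C _).
case Ea: (resdim_class X C) => [a|]; last by case: (enat_sup C _).
have /enat_supP pdp : (pd_rel_class X X <= Fin p)%EN by rewrite Ep /=.
have /enat_supP resa : (resdim_class X C <= Fin a)%EN by rewrite Ea /=.
rewrite -[(Fin p + _)%EN]/(Fin (p + a)); apply/enat_supP => M CM.
(* The length [m] does not enter the bound; its finiteness starts the descent to length p + n, where
   [n] is the length of an [X]-resolution. *)
have [m Mm] := finite_pd_resolved (C_pd M CM).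
have /enat_leastP[n na Mn] := resa M CM.
apply/enat_leastP; exists (p + n)%N; first by rewrite leq_add2l.
apply: resolved_by_projective_Ext_zero Mm _ => P /projX XP.
apply: resolved_by_Ext_zero Mn => L XL j pj.
have /enat_leastP[q qp Lq] := pdp L XL.
exact/Lq/leq_ltn_trans/pj.
Qed.

(* Right R-modules are left modules over the converse ring R^c. *)
Theorem theorem4p3 (R : pzRingType) (A B : module_class R^c) :
  cotorsion_pair A B -> complete_pair A B -> hereditary_pair A B ->
  pd_rel_class A A <> Infty ->
  let alpha := resdim_class A (@finite_pd R^c) in
  let beta := resdim_class A (@finite_pd_fg R^c) in
  ((alpha <= Findim R^c)%EN /\
   (Findim R^c <= pd_rel_class A A + alpha)%EN) /\
  ((beta <= findim R^c)%EN /\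
   (findim R^c <= pd_rel_class A A + beta)%EN).
Proof.
move=> [AB _] _ _ _ alpha beta.
(* [A] is the left Ext^1-orthogonal of [B], and Ext^1 vanishes on projective modules. *)
have projA P : projective P -> A P.
  by move=> Pproj; apply/AB => N _; apply: projective_Ext_zero.
split; split.
- exact: resdim_le_Findim.
- exact: Findim_le_pd_rel_add_resdim.
- exact: resdim_le_Findim.
- by apply: Findim_le_pd_rel_add_resdim => // M [].
Qed.
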